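(* The projective unitary group $\mathrm{PU}(3,2^2)$ is isomorphic to the semidirect product $(\mathbb{Z}/3)^2\rtimes\mathrm{SL}(2,3)$, where $\mathrm{SL}(2,3)=\mathrm{SL}_2(\mathbb{Z}/3)$ acts on $(\mathbb{Z}/3)^2$ in the natural way, and the projective special unitary group $\mathrm{PSU}(3,2^2)$ is isomorphic to the semidirect product $(\mathbb{Z}/3)^2\rtimes Q_8$ of $(\mathbb{Z}/3)^2$ and the quaternion group $Q_8$, where $Q_8$ is the Sylow $2$-subgroup of $\mathrm{SL}(2,3)$, acting by restriction of the natural action.
   Context: Let $\mathbb{F}_4$ be the field of four elements. $\mathrm{U}(3,2^2)$ is the subgroup of $\mathrm{GL}_3(\mathbb{F}_4)$ consisting of the matrices $a$ with $a^\dagger a=1$, where $a^\dagger$ is the transpose of the matrix obtained from $a$ by applying $\alpha\mapsto\alpha^2$ to all entries. $\mathrm{PU}(3,2^2)$ is the quotient of $\mathrm{U}(3,2^2)$ by its subgroup of scalar matrices, and $\mathrm{PSU}(3,2^2)$ is the quotient of $\mathrm{SU}(3,2^2)=\{a\in\mathrm{U}(3,2^2):\det a=1\}$ by its subgroup of scalar matrices. *)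

(* Defs.v *)
From mathcomp Require Import all_boot all_order all_algebra all_fingroup.
From mathcomp Require Import all_solvable all_field all_character.

Set Implicit Arguments.
Unset Strict Implicit.
Unset Printing Implicit Defensive.

Import GRing.Theory.
Local Open Scope ring_scope.

Section LinearGroups.

Variables (F : finFieldType) (n : nat).

(* The elements of {'GL_n[F]} are matrices of size n.-1.+1, i.e. n for n > 0. *)
Definition SL_set : {set {'GL_n[F]}} :=
  [set a : {'GL_n[F]} | \det (GLval a) == 1].

Lemma SL_group_set : group_set SL_set.
Proof.
apply/group_setP; split=> [|a b]; first by rewrite inE GL_1E det1.
by rewrite !inE GL_MxE det_mulmx => /eqP-> /eqP->; rewrite mulr1.
Qed.
Definition SL : {group {'GL_n[F]}} := Group SL_group_set.

Definition scalar_set : {set {'GL_n[F]}} :=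
  [set a : {'GL_n[F]} | is_scalar_mx (GLval a)].

Lemma scalar_group_set : group_set scalar_set.
Proof.
apply/group_setP; split=> [|a b]; first by rewrite inE GL_1E scalar_mx_is_scalar.
rewrite !inE GL_MxE => /is_scalar_mxP[x ->] /is_scalar_mxP[y ->].
by rewrite -scalar_mxM scalar_mx_is_scalar.
Qed.
Definition scalars : {group {'GL_n[F]}} := Group scalar_group_set.

End LinearGroups.

Arguments SL : clear implicits.
Arguments scalars : clear implicits.

(* MathComp actions are right actions, so the natural action of G <= GL_n(F)  *)
(* on F^n is v |-> v *m a on row vectors. Composing with the automorphism     *)
(* a |-> a^-1^T of GL_n(F) (it preserves SL_n(F), hence also a unique Sylow   *)
(* p-subgroup of it) and transposing vectors turns it into the left action    *)
(* v |-> a *m v on column vectors, so the semidirect products are isomorphic. *)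
Definition natural_action (F : finFieldType) (n : nat)
    (G : {group {'GL_n.+1[F]}}) : groupAction G [set: 'rV[F]_n.+1] :=
  ('MR (GLrepr F n) \ subsetT G)%gact.

Section Unitary.

Variables (F : finFieldType) (n : nat).

Definition dagger (a : 'M[F]_n.-1.+1) : 'M[F]_n.-1.+1 :=
  (map_mx (fun x => x ^+ 2) a)^T.

Definition unitary_set : {set {'GL_n[F]}} :=
  [set a : {'GL_n[F]} | dagger (GLval a) *m GLval a == 1%:M].

Hypothesis cardF : #|F| = 4.

Let char2 : 2 \in [pchar F].
Proof. by apply: (@card_finPcharP _ _ 2). Qed.

Let dagger_frob a : dagger a = (map_mx (pFrobenius_aut char2) a)^T.
Proof. by congr trmx; apply/matrixP=> i j; rewrite !mxE pFrobenius_autE. Qed.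

Lemma unitary_group_set : group_set unitary_set.
Proof.
apply/group_setP; split=> [|a b].
  by rewrite inE GL_1E dagger_frob map_mx1 trmx1 mulmx1.
rewrite !inE !dagger_frob GL_MxE map_mxM trmx_mul => /eqP ha /eqP hb.
by rewrite mulmxA -(mulmxA _ _ (GLval a)) ha mulmx1 hb.
Qed.
Definition unitary : {group {'GL_n[F]}} := Group unitary_group_set.

Definition special_unitary : {group {'GL_n[F]}} := (unitary :&: SL F n)%G.

Definition proj_unitary : {group coset_of (unitary :&: scalars F n)} :=
  (unitary / (unitary :&: scalars F n))%G.

Definition proj_special_unitary :
    {group coset_of (special_unitary :&: scalars F n)} :=
  (special_unitary / (special_unitary :&: scalars F n))%G.

End Unitary.

Arguments proj_unitary [F] n cardF.
Arguments proj_special_unitary [F] n cardF.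

(* Main.v *)
Require Import Defs.
From mathcomp Require Import all_boot all_order all_algebra all_fingroup.
From mathcomp Require Import all_solvable all_field all_character.
From mathcomp Require Import ring.

(* Index the coordinates of F^3 by F_3 and let w be a primitive cube root of
   unity of F. The Weyl operators, i.e. the products of a cyclic shift and a
   diagonal matrix with entries w^(q x), are unitary, commute up to scalars,
   and realise (Z/3)^2 in PU(3, 2^2). For g in SL(2, 3) the average T_g =
   sum_u W(u)^-1 W(u g) satisfies W(v) T_g = T_g W(v g). Its trace is the
   number of fixed points of g, which is odd, hence 1 in F; this makes T_g
   unitary, because T_g^dagger T_g = tr(T_g) 1. By Schur's lemma g |-> T_g is
   projectively multiplicative, so we get an injective morphism from (Z/3)^2
   ><| SL(2, 3) to PU(3, 2^2). It is onto as unitary matrices are products of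
   diagonal matrices, permutation matrices and Fourier transforms: a row of a
   unitary matrix has one or three nonzero entries, since its norm is the
   number of these modulo 2. Scalars of F^* have trivial cube, so det is
   defined on PU(3, 2^2); it is trivial on Weyl operators and its kernel on
   SL(2, 3) has index 3, hence is the normal Sylow 2-subgroup. *)

Set Implicit Arguments.
Unset Strict Implicit.
Unset Printing Implicit Defensive.

Import GRing.Theory.
Local Open Scope ring_scope.

(* The ring tactic does not know that 3 = 0 in F_3; identities that need this *)
(* are proved by first adding a suitable multiple of 3.                       *)
Lemma three_F3 (a : 'F_3) : 3%:R * a = 0.
Proof.
by rewrite mulr_natl; exact: (mulrn_pchar (pchar_Fp (isT : prime 3))).
Qed.

(** * Matrices of size two and the group SL(2, 3) *)

Lemma lift01 : lift ord0 ord0 = 1 :> 'I_2. Proof. exact: val_inj. Qed.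

Lemma sum_ord2 (V : nmodType) (f : 'I_2 -> V) : \sum_i f i = f 0 + f 1.
Proof. by rewrite !big_ord_recl big_ord0 addr0 lift01. Qed.

Lemma det_mx22 (R : comNzRingType) (A : 'M[R]_2) :
  \det A = A 0 0 * A 1 1 - A 0 1 * A 1 0.
Proof.
rewrite (expand_det_row A 0) sum_ord2 /cofactor !det_mx11 !mxE lift01.
rewrite (_ : lift 1 0 = 0); last exact: val_inj.
by rewrite addn0 add0n expr0 expr1 mul1r mulN1r mulrN.
Qed.

(** The image is a nontrivial subgroup of a group of prime order, hence everything. *)
Lemma index_ker_prime (aT rT : finGroupType) (D : {group aT})
    (f : {morphism D >-> rT}) :
  prime #|[set: rT]| -> (exists2 x, x \in D & f x != 1%g) ->
  #|D : 'ker f|%g = #|[set: rT]|.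
Proof.
move=> pr_rT [x Dx nt_fx]; have := card_morphim f D; rewrite setIid => <-.
have /cardSg/=/(primeP pr_rT).2 := subsetT (f @* D)%G.
case/pred2P=> // /card1_trivg im1; case/eqP: nt_fx; apply/set1P.
by rewrite -[set1 _]im1 mem_morphim.
Qed.

Lemma mx22_eq (R : nzRingType) (A B : 'M[R]_2) :
  A 0 0 = B 0 0 -> A 0 1 = B 0 1 -> A 1 0 = B 1 0 -> A 1 1 = B 1 1 -> A = B.
Proof.
have ordE (i : 'I_2) : i = 0 \/ i = 1.
  by case: i => [[|[|]]] // lt; [left | right]; apply: val_inj.
by move=> *; apply/matrixP=> i j; case: (ordE i) (ordE j) => -> [] ->.
Qed.

(** Cayley-Hamilton in size two. *)
Lemma sqmx_det1 (R : comNzRingType) (A : 'M[R]_2) : \det A = 1 ->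
  A *m A = \tr A *: A - 1%:M.
Proof.
move=> <-; rewrite /mxtrace sum_ord2 det_mx22.
by apply: mx22_eq; rewrite !mxE sum_ord2 /=; ring.
Qed.

Definition mx22 (R : nzRingType) (a b c d : R) : 'M[R]_2 :=
  \matrix_(i, j) if i == 0 then (if j == 0 then a else b)
                 else (if j == 0 then c else d).

Lemma det_mx22E (R : comNzRingType) (a b c d : R) :
  \det (mx22 a b c d) = a * d - b * c.
Proof. by rewrite det_mx22 !mxE. Qed.

Lemma F3_cases (x : 'F_3) : [|| x == 0, x == 1 | x == - 1].
Proof. by case: x => [[|[|[|]]]]. Qed.

(** The default [1] is never taken, since the determinant of [a] is a unit. *)
Definition GLdet (n : nat) (F : finFieldType) (a : {'GL_n[F]}) : {unit F} :=
  insubd (1%g : {unit F}) (\det (GLval a)).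

Lemma GLdetE (n : nat) (F : finFieldType) (a : {'GL_n[F]}) :
  FinRing.uval (GLdet a) = \det (GLval a).
Proof.
by apply: (insubdK (1%g : {unit F})); rewrite [_ \in _]unitfE GL_det.
Qed.

Lemma GLdetM (n : nat) (F : finFieldType) :
  {in [set: {'GL_n[F]}] &, {morph @GLdet n F : a b / (a * b)%g}}.
Proof.
move=> a b _ _; apply: val_inj; rewrite /= !GLdetE.
exact: det_mulmx.
Qed.

Canonical GLdet_morphism n F := Morphism (@GLdetM n F).

Lemma card_SL23 : #|SL 'F_3 2| = 24%N.
Proof.
have ->: SL 'F_3 2 = ('ker (@GLdet 2 'F_3))%G.
  by apply/val_inj/setP=> a; rewrite !inE -[_ == 1%g]val_eqE /= GLdetE.
have oU : #|[set: {unit 'F_3}]| = 2%N by rewrite card_finField_unit card_Fp.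
have nt_det : exists2 a, a \in [set: {'GL_2['F_3]}] & GLdet a != 1%g.
  have det_g : \det (mx22 1 0 0 (- 1) : 'M['F_3]_2) = - 1.
    by rewrite det_mx22E; ring.
  have Ug : mx22 1 0 0 (- 1) \in (unitmx : pred 'M['F_3]_2).
    by rewrite unitmxE det_g.
  exists (FinRing.Unit Ug : {'GL_2['F_3]}); rewrite ?inE //.
  by rewrite -val_eqE /= GLdetE det_g.
have iK : #|[set: {'GL_2['F_3]}] : 'ker (@GLdet 2 'F_3)|%g = 2%N.
  have prU : prime #|[set: {unit 'F_3}]| by rewrite oU.
  exact: etrans (index_ker_prime (f := @GLdet_morphism 2 'F_3) prU nt_det) oU.
have := Lagrange (subsetT ('ker (@GLdet 2 'F_3))%G).
rewrite iK card_GL_2 card_Fp //=.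
by move=> e; apply/eqP; rewrite -(eqn_pmul2r (ltn0Sn 1)) e.
Qed.

(** Cayley-Hamilton turns a^2 = 1 into tr(a) a = 2 = -1, which excludes trace 0. *)
Lemma SL23_sq1 (a : {'GL_2['F_3]}) : a \in SL 'F_3 2 ->
  (a ^+ 2 = 1)%g -> GLval a = 1%:M \/ GLval a = - 1%:M.
Proof.
rewrite inE => /eqP det_a sq_a.
have /eqP: GLval a *m GLval a = 1%:M :> 'M['F_3]_2.
  by rewrite -GL_MxE (sq_a : (a * a)%g = 1%g).
rewrite (sqmx_det1 det_a) subr_eq => /eqP.
have -> : 1%:M + 1%:M = - 1%:M :> 'M['F_3]_2.
  by apply: mx22_eq; rewrite !mxE; apply: val_inj.
case/or3P: (F3_cases (\tr (GLval a))) => /eqP->.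
- by rewrite scale0r => /matrixP/(_ 0 0); rewrite !mxE.
- by rewrite scale1r; right.
- by rewrite scaleN1r => /oppr_inj; left.
Qed.

(** By Cayley-Hamilton, a^2 = -1 for trace 0, a^3 = -1 for trace 1 and a^3 = 1 for trace -1. *)
Lemma SL23_exp12 (a : {'GL_2['F_3]}) : a \in SL 'F_3 2 -> (a ^+ 12 = 1)%g.
Proof.
rewrite inE => /eqP/sqmx_det1; rewrite -/(_ * _) -expr2 => sq_a.
apply: val_inj; rewrite FinRing.val_unitX /=.
have cube_a : GLval a ^+ 3 = (\tr a ^+ 2 - 1) *: GLval a - (\tr a)%:M.
  rewrite exprS sq_a mulrBr -scalerAr mulr1 -expr2 sq_a scalerBr scalerA.
  by rewrite scalemx1 scalerBl scale1r -expr2 addrAC.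
case/or3P: (F3_cases (\tr a)) => /eqP tr_a.
- by rewrite (exprM _ 2 6) sq_a tr_a scale0r sub0r -signr_odd.
- rewrite (exprM _ 3 4) cube_a tr_a expr1n subrr scale0r sub0r.
  by rewrite -[1%:M]/(1 : 'M__) -signr_odd.
- rewrite (exprM _ 3 4) cube_a tr_a sqrrN expr1n subrr scale0r sub0r.
  by rewrite raddfN opprK expr1n.
Qed.

(* A noncyclic 2-group with a unique involution is generalized quaternion;    *)
(* here the involution is -1, and there is no element of order 8.             *)
Lemma SL23_quaternion (Q : {group {'GL_2['F_3]}}) :
  Q \subset SL 'F_3 2 -> #|Q| = 8%N -> Q \isog 'Q_8.
Proof.
move=> sQ oQ; have pQ : (2.-group Q)%g by rewrite /pgroup oQ.
have ntQ : Q :!=: 1%g by rewrite -cardG_gt1 oQ.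
have Ohm2 : #|('Ohm_1(Q))%g| = 2%N.
  have [|x Qx ox] := @Cauchy _ 2 Q isT; first by rewrite oQ.
  have x_neq1 : x != 1%g by apply: contra_eqN ox => /eqP->; rewrite order1.
  have sq1 (y : {'GL_2['F_3]}) : y \in Q -> (y ^+ 2 = 1)%g ->
      y = 1%g \/ GLval y = - 1%:M.
    move=> /(subsetP sQ) Sy /(SL23_sq1 Sy)[y1|]; last by right.
    by left; apply: val_inj.
  have x2 : (x ^+ 2 = 1)%g by have := expg_order x; rewrite ox.
  have [/eqP|def_x] := sq1 x Qx x2; first by rewrite (negPf x_neq1).
  suff -> : ('Ohm_1(Q) = <[x]>)%g by [].
  apply/eqP; rewrite eqEsubset (OhmE 1 pQ) gen_subG cycle_subG.
  have xL : x \in ('Ldiv_(2 ^ 1)(Q))%g by rewrite !inE Qx -order_dvdn ox.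
  rewrite mem_gen // andbT; apply/subsetP=> y /LdivP[Qy /(sq1 y Qy)[->|def_y]].
    exact: group1.
  suff -> : y = x by apply: cycle_id.
  by apply: val_inj; rewrite -[LHS]/(GLval y) def_y -def_x.
have := introT (prime_Ohm1P pQ ntQ) Ohm2.
case/orP=> [/cyclicP[a defQ]|/andP[_ /eqP]].
  have Qa : a \in Q by rewrite defQ cycle_id.
  have := order_dvdn a 12; rewrite SL23_exp12 ?(subsetP sQ) // eqxx.
  by rewrite orderE -defQ oQ.
case/quaternion_classP=> n n_gt2 isoQ; have := card_isog isoQ.
rewrite oQ card_quaternion // -[8%N]/(2 ^ 3)%N => /eqP.
rewrite eqn_exp2l // => /eqP n3.
by rewrite -n3 in isoQ.
Qed.

Lemma normal_SylowE (gT : finGroupType) p (G P : {group gT}) :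
  (p.-Sylow(G) P)%g -> (P <| G)%g -> ('Syl_p(G) = [set P])%g.
Proof.
move=> sylP /andP[_ nPG]; apply/setP=> R; rewrite !inE.
apply/idP/eqP=> [sylR | ->//].
have [x Gx defR] := Sylow_trans sylP sylR.
by apply: val_inj; rewrite /= defR (normsP nPG).
Qed.

Lemma SL_det (a : {'GL_2['F_3]}) : a \in SL 'F_3 2 -> \det (GLval a) = 1.
Proof. by rewrite inE => /eqP. Qed.

(** * The field of four elements and a character of F_3 with values in it *)

Section Heisenberg.

Variables (F : finFieldType) (w : F).
Hypotheses (cardF : #|F| = 4%N) (w_neq0 : w != 0) (w_neq1 : w != 1).

Lemma F4_pchar : 2%N \in [pchar F].
Proof. exact: (@card_finPcharP _ _ 2). Qed.

Lemma F4_char2 : 1 + 1 = 0 :> F.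
Proof. by have /andP[_ /eqP] := F4_pchar. Qed.

Lemma natr_F4 n : n%:R = (odd n)%:R :> F.
Proof. by rewrite -(GRing.natr_mod_pchar F4_pchar) modn2. Qed.

Lemma expf3 (a : F) : a != 0 -> a ^+ 3 = 1.
Proof.
by move=> nz_a; apply: (mulfI nz_a); rewrite -exprS -cardF expf_card mulr1.
Qed.

Lemma w_cubed : w ^+ 3 = 1. Proof. exact: expf3. Qed.

Lemma w_sum : 1 + w + w ^+ 2 = 0.
Proof.
apply: (mulfI (x := w - 1)); first by rewrite subr_eq0.
rewrite mulr0 -[RHS](subrr 1) -[X in _ = X - _]w_cubed; ring.
Qed.

Definition psi (a : 'F_3) : F := w ^+ a.

Lemma psi0 : psi 0 = 1. Proof. by []. Qed.

Lemma psiD a b : psi (a + b) = psi a * psi b.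
Proof.
by rewrite /psi -exprD -(expr_mod (a + b)%N w_cubed).
Qed.

Lemma psi_neq0 a : psi a != 0.
Proof. by rewrite expf_neq0. Qed.

Lemma psiN a : psi (- a) = (psi a)^-1.
Proof.
by apply: (mulfI (psi_neq0 a)); rewrite -psiD subrr mulfV ?psi_neq0.
Qed.

(** Orthogonality of characters; the sum of three ones is 1 in characteristic 2. *)
Lemma sum_psi (a : 'F_3) : \sum_(q : 'F_3) psi (q * a) = (a == 0)%:R.
Proof.
rewrite !big_ord_recl big_ord0.
case: a => [[|[|[|]]]] // lt; rewrite /psi /= ?expr0 ?expr1 addr0 ?addrA.
- by rewrite F4_char2 add0r.
- exact: w_sum.
- by rewrite addrAC w_sum.
Qed.

(** Squaring inverts cube roots of unity, as complex conjugation does. *)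
Lemma psi_sq a : psi a ^+ 2 = psi (- a).
Proof.
apply: (mulfI (psi_neq0 a)); rewrite -exprS -psiD subrr.
by rewrite /psi -exprM mulnC exprM w_cubed expr1n.
Qed.

Lemma psi_eq1 a : (psi a == 1) = (a == 0).
Proof.
case: a => [[|[|[|]]]] // lt; rewrite /psi /= ?eqxx // ?(negPf w_neq1) //.
transitivity false => //; apply/negbTE/eqP=> w2; case/eqP: w_neq1.
by rewrite -[w]mulr1 -w2 -exprS w_cubed.
Qed.

(** * Weyl operators *)

Implicit Types (u v : 'rV['F_3]_2) (x y : 'I_3) (A B : 'M[F]_3)
  (g : 'M['F_3]_2).

(* The normalising phase is psi(p q / 2) = psi(- p q), as 1/2 = -1 in F_3; it *)
(* makes the cocycle in weyl_mul alternating, hence SL(2, 3)-invariant.       *)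
Definition weyl v : 'M[F]_3 :=
  \matrix_(x, y) (psi (v 0 1 * x - v 0 0 * v 0 1) *+ (y == x + v 0 0)).

Lemma weylE v x y :
  weyl v x y = psi (v 0 1 * x - v 0 0 * v 0 1) *+ (y == x + v 0 0).
Proof. by rewrite mxE. Qed.

(** The standard symplectic form on F_3^2. *)
Definition omega u v : 'F_3 := u 0 0 * v 0 1 - u 0 1 * v 0 0.

Lemma mul_weylmx v A x y :
  (weyl v *m A) x y = psi (v 0 1 * x - v 0 0 * v 0 1) * A (x + v 0 0) y.
Proof.
rewrite mxE (bigD1 (x + v 0 0)) //= big1 => [|z /negPf neq]; rewrite mxE.
  by rewrite eqxx addr0.
by rewrite neq mul0r.
Qed.

Lemma mul_mxweyl v A x y :
  (A *m weyl v) x y = A x (y - v 0 0) * psi (v 0 1 * y + v 0 0 * v 0 1).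
Proof.
rewrite mxE (bigD1 (y - v 0 0)) //= big1 => [|z neq]; rewrite mxE.
  rewrite subrK eqxx addr0; congr (_ * psi _).
  rewrite -[RHS]subr0 -(three_F3 (v 0 0 * v 0 1)); ring.
by rewrite -subr_eq eq_sym (negPf neq) mulr0.
Qed.

Lemma weyl_mul u v :
  weyl u *m weyl v = psi (- omega u v) *: weyl (u + v).
Proof.
apply/matrixP=> x y; rewrite mul_weylmx !mxE addrA !mulrnAr -!psiD.
congr (_ *+ _); congr (psi _).
rewrite /omega -[LHS]subr0 -(three_F3 (u 0 0 * v 0 1)); ring.
Qed.

(** The cocycles of the two products are opposite, and -2 = 1 in F_3. *)
Lemma weyl_comm u v :
  weyl u *m weyl v = psi (omega u v) *: (weyl v *m weyl u).
Proof.
rewrite !weyl_mul scalerA -psiD addrC [v + u]addrC; congr (psi _ *: _).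
rewrite -[RHS]subr0 -(three_F3 (omega u v)) /omega; ring.
Qed.

Lemma weyl0 : weyl 0 = 1%:M.
Proof. by apply/matrixP=> x y; rewrite !mxE !mul0r subrr addr0 eq_sym. Qed.

Lemma omega_opp u : omega (- u) u = 0.
Proof. rewrite /omega !mxE; ring. Qed.

Lemma weylNK u : weyl (- u) *m weyl u = 1%:M.
Proof. by rewrite weyl_mul omega_opp oppr0 psi0 scale1r addNr weyl0. Qed.

Lemma weylKN u : weyl u *m weyl (- u) = 1%:M.
Proof. by rewrite -{1}[u]opprK weylNK. Qed.

Lemma row2P u v : u 0 0 = v 0 0 -> u 0 1 = v 0 1 -> u = v.
Proof.
move=> e0 e1; apply/rowP; case=> [[|[|]]] // lt.
- by rewrite (_ : Ordinal lt = 0) //; apply: val_inj.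
- by rewrite (_ : Ordinal lt = 1) //; apply: val_inj.
Qed.

(** A nonzero shift has no diagonal entries; otherwise the trace is a character sum, or 3 = 1 for
    the identity. *)
Lemma mxtrace_weyl u : \tr (weyl u) = (u == 0)%:R.
Proof.
have [-> | nz_u] := eqVneq u 0.
  by rewrite weyl0 mxtrace1 mulrS (mulrS _ 1) F4_char2 addr0.
rewrite /mxtrace; under eq_bigr do rewrite mxE.
have [u0|nz] := eqVneq (u 0 0) 0; last first.
  by rewrite big1 // => x _; rewrite -subr_eq0 opprD addNKr oppr_eq0 (negPf nz).
under eq_bigr do rewrite u0 addr0 mul0r subr0 eqxx mulr1n mulrC.
rewrite sum_psi; case: eqP => // u1; case/eqP: nz_u.
by apply: row2P; rewrite mxE.
Qed.

Lemma sum_row2 (f : 'F_3 -> 'F_3 -> F) :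
  \sum_(v : 'rV['F_3]_2) f (v 0 0) (v 0 1) = \sum_p \sum_q f p q.
Proof.
rewrite pair_bigA /= [RHS](reindex (fun v : 'rV_2 => (v 0 0, v 0 1))) //=.
exists (fun a => \row_i if i == 0 then a.1 else a.2) => [v|[p q]] _ /=.
  by apply: row2P; rewrite mxE.
by rewrite !mxE.
Qed.

(** Summing over the second coordinate of [v] kills the off-diagonal entries by orthogonality;
    summing over the first one turns each diagonal entry into the trace. *)
Lemma weyl_average A : \sum_v weyl (- v) *m A *m weyl v = (\tr A)%:M.
Proof.
apply/matrixP=> x y; rewrite summxE mxE.
under eq_bigr do rewrite mul_mxweyl mul_weylmx !mxE.
rewrite (sum_row2 (fun p q => psi (- q * x - - p * - q) * A (x - p) (y - p)
                              * psi (q * y + p * q))).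
transitivity (\sum_p A (x - p) (y - p) * (y - x == 0)%:R).
  apply: eq_bigr => p _; rewrite -sum_psi mulr_sumr; apply: eq_bigr => q _.
  by rewrite mulrAC -psiD mulrC; congr (_ * psi _); ring.
rewrite -mulr_suml subr_eq0 eq_sym; case: eqP => [->|_]; last by rewrite mulr0.
by rewrite mulr1 mulr1n [RHS](reindex_inj (inj_comp (addrI y) oppr_inj)).
Qed.

(** Such a matrix equals its own average, because 9 = 1 in [F]. *)
Lemma weyl_schur A : (forall v, weyl v *m A = A *m weyl v) -> is_scalar_mx A.
Proof.
move=> cA; apply/is_scalar_mxP; exists (\tr A); rewrite -weyl_average.
under eq_bigr do rewrite cA -mulmxA weylNK mulmx1.
by rewrite sumr_const card_mx card_Fp // -scaler_nat natr_F4 scale1r.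
Qed.

(** * Adjoints, unitary matrices and Weil operators *)

Definition adj A : 'M[F]_3 := @dagger F 3 A.

Lemma adjE A x y : adj A x y = A y x ^+ 2.
Proof. by rewrite !mxE. Qed.

Lemma sqrD2 (a b : F) : (a + b) ^+ 2 = a ^+ 2 + b ^+ 2.
Proof. by rewrite sqrrD -mulr_natr natr_F4 mulr0 addr0. Qed.

Lemma adj_sum (I : Type) (r : seq I) (P : pred I) (f : I -> 'M[F]_3) :
  adj (\sum_(i <- r | P i) f i) = \sum_(i <- r | P i) adj (f i).
Proof.
apply: (big_morph adj).
  by move=> A B; apply/matrixP=> x y; rewrite !mxE sqrD2.
by apply/matrixP=> x y; rewrite !mxE expr0n.
Qed.

Lemma adjM A B : adj (A *m B) = adj B *m adj A.
Proof.
apply/matrixP=> x y; rewrite !mxE.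
rewrite (big_morph (fun a : F => a ^+ 2) sqrD2 (expr0n _ _)).
by apply: eq_bigr => z _; rewrite !mxE exprMn mulrC.
Qed.

Lemma adj_weyl v : adj (weyl v) = weyl (- v).
Proof.
apply/matrixP=> x y; rewrite adjE !mxE [y == _]eq_sym subr_eq.
case: eqP => [->|_]; last by rewrite expr0n.
rewrite !mulr1n psi_sq; congr (psi _).
rewrite -[LHS]subr0 -(three_F3 (v 0 0 * v 0 1)); ring.
Qed.

Lemma omegaM u v g : omega (u *m g) (v *m g) = \det g * omega u v.
Proof.
rewrite det_mx22 /omega !mxE !sum_ord2; ring.
Qed.

Definition is_unitary A := adj A *m A == 1%:M.

(** The sum has 9 terms and 9 = 1 in [F], so it is an average without any division. *)
Definition weil g : 'M[F]_3 := \sum_u weyl (- u) *m weyl (u *m g).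

Section SpecialLinear.

Variable g : 'M['F_3]_2.
Hypothesis det_g : \det g = 1.

Let inj_g : injective (fun u => u *m g).
Proof. by apply: can_inj (mulmxK _); rewrite unitmxE det_g unitr1. Qed.

(** Translate the summation variable by [v]; the phases agree because [g] preserves [omega]. *)
Lemma weil_weyl v : weil g *m weyl (v *m g) = weyl v *m weil g.
Proof.
rewrite mulmx_suml mulmx_sumr [RHS](reindex_inj (addIr v)) /=.
apply: eq_bigr => u _; rewrite mulmxDl -mulmxA weyl_mul mulmxA weyl_mul.
have ->: v - (u + v) = - u by rewrite opprD addrCA subrr addr0.
rewrite -scalemxAl -scalemxAr; congr (psi _ *: _).
by rewrite omegaM det_g mul1r /omega !mxE; ring.
Qed.

(** Only fixed vectors of [g] contribute, each with 1; they form a subgroup of a group of order 9,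
    so their number is odd. *)
Lemma mxtrace_weil : \tr (weil g) = 1.
Proof.
have trE u : \tr (weyl (- u) *m weyl (u *m g)) = (u *m g == u)%:R.
  rewrite weyl_mul mxtraceZ mxtrace_weyl addrC subr_eq0.
  case: eqP => [->|_]; last by rewrite mulr0.
  by rewrite omega_opp oppr0 mulr1.
rewrite raddf_sum /= (eq_bigr _ (fun u _ => trE u)) -natr_sum.
pose fixed := [set u : 'rV_2 | u *m g == u].
have ->: (\sum_(u : 'rV_2) (u *m g == u) = #|fixed|)%N.
  by rewrite -sum1dep_card [RHS]big_mkcond; apply: eq_bigr => u _; case: eqP.
have fix_group : group_set fixed.
  apply/group_setP; split=> [|u v]; first by rewrite inE mul0mx.
  by rewrite !inE mulmxDl => /eqP-> /eqP->.
have /cardSg := subsetT (Group fix_group).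
by rewrite cardsT card_mx card_Fp // natr_F4 => /dvdn_odd ->.
Qed.

(** Write 1 as the trace, hence as the Weyl average of [weil g], reindexed by [g]. Moving Weyl
    operators across [weil g] leaves the adjoints of its summands on the left. *)
Lemma weil_unitary : is_unitary (weil g).
Proof.
apply/eqP; rewrite -mxtrace_weil -weyl_average adj_sum mulmx_suml.
rewrite [RHS](reindex_inj inj_g) /=.
apply: eq_bigr => u _; rewrite adjM !adj_weyl opprK -!mulmxA.
by rewrite weil_weyl.
Qed.

End SpecialLinear.

(** * Projective classes of unitary matrices *)

Local Notation U := (unitary 3 cardF).
Local Notation Z := (U :&: scalars F 3).

(** Singular matrices are sent to the default [1]; only unitary ones matter below. *)
Definition toGL A : {'GL_3[F]} := insubd (1%g : {'GL_3[F]}) A.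

Lemma toGLK A : is_unitary A -> GLval (toGL A) = A.
Proof.
move=> /eqP/mulmx1_unit[_ uA].
exact: (insubdK (1%g : {'GL_3[F]})).
Qed.

Lemma mem_toGL A : is_unitary A -> toGL A \in U.
Proof. by move=> uA; rewrite inE toGLK. Qed.

Lemma is_unitaryV A : is_unitary A -> A *m adj A = 1%:M.
Proof. by move/eqP/mulmx1C. Qed.

Lemma is_unitary_det A : is_unitary A -> \det A != 0.
Proof. by move/eqP/mulmx1_unit=> [_]; rewrite unitmxE unitfE. Qed.

Lemma is_unitaryM A B : is_unitary A -> is_unitary B -> is_unitary (A *m B).
Proof.
rewrite /is_unitary => /eqP uA /eqP uB.
by rewrite adjM mulmxA -(mulmxA (adj B)) uA mulmx1 uB.
Qed.

Lemma weyl_unitary v : is_unitary (weyl v).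
Proof. by rewrite /is_unitary adj_weyl weylNK. Qed.

Lemma toGLM A B :
  is_unitary A -> is_unitary B -> toGL (A *m B) = (toGL A * toGL B)%g.
Proof.
move=> uA uB.
suff: GLval (toGL (A *m B)) = GLval (toGL A * toGL B)%g by exact: val_inj.
by rewrite GL_MxE !toGLK // is_unitaryM.
Qed.

Lemma unitary_normZ : (U \subset 'N(Z))%g.
Proof.
apply: subset_trans (cent_sub _); rewrite centsC; apply/centsP=> z /setIP[_].
rewrite inE => /is_scalar_mxP[c zc] a _.
suff: GLval (z * a)%g = GLval (a * z)%g by exact: val_inj.
by rewrite !GL_MxE zc scalar_mxC.
Qed.

Definition proj A : coset_of Z := coset Z (toGL A).

Lemma projM A B :
  is_unitary A -> is_unitary B -> proj (A *m B) = (proj A * proj B)%g.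
Proof.
move=> uA uB; rewrite /proj toGLM // morphM //;
  by rewrite (subsetP unitary_normZ) ?mem_toGL.
Qed.

(** Every nonzero scalar has norm c^3 = 1, so equality of projective classes is plain
    proportionality. *)
Lemma is_unitaryZ c A : c != 0 -> is_unitary A -> is_unitary (c *: A).
Proof.
move=> nz_c /eqP uA; apply/eqP; rewrite -uA.
have -> : adj (c *: A) = c ^+ 2 *: adj A.
  by apply/matrixP=> x y; rewrite !mxE exprMn.
by rewrite -scalemxAl -scalemxAr scalerA -exprSr expf3 // scale1r.
Qed.

Lemma proj_eq A B : is_unitary A -> is_unitary B ->
  reflect (exists2 c, c != 0 & A = c *: B) (proj A == proj B).
Proof.
move=> uA uB; have nZ := subsetP unitary_normZ.
have uAB c : A = c *: B -> c != 0.
  move=> defA; apply: contraNneq (is_unitary_det uA) => c0.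
  by rewrite defA c0 scale0r det0.
have defAB: GLval (toGL A * (toGL B)^-1)%g = A *m adj B.
  rewrite GL_MxE GL_VxE !toGLK //.
  congr (_ *m _); have [_ UB] := mulmx1_unit (eqP uB).
  by rewrite -[RHS](mulmxK UB) (eqP uB) mul1mx.
have ->: (proj A == proj B) = is_scalar_mx (A *m adj B).
  rewrite -defAB; have [nA nB] := (nZ _ (mem_toGL uA), nZ _ (mem_toGL uB)).
  apply/eqP/idP => [/(rcoset_kercosetP nA nB) | sAB].
    by rewrite mem_rcoset => /setIP[_]; rewrite inE.
  apply/(rcoset_kercosetP nA nB).
  by rewrite mem_rcoset in_setI groupM ?groupV ?mem_toGL //= inE.
apply: (iffP (@is_scalar_mxP _ _ _)) => [[c defA]|[c nz_c ->]]; exists c.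
  by apply: uAB; rewrite -[A]mulmx1 -(eqP uB) mulmxA defA mul_scalar_mx.
  by rewrite -[A]mulmx1 -(eqP uB) mulmxA defA mul_scalar_mx.
by rewrite -scalemxAl is_unitaryV // scalemx1.
Qed.

Lemma projZ c A : c != 0 -> is_unitary A -> proj (c *: A) = proj A.
Proof.
by move=> nz_c uA; apply/eqP/proj_eq => //; [exact: is_unitaryZ | exists c].
Qed.

Lemma proj1 : proj 1%:M = 1%g.
Proof.
rewrite /proj (_ : toGL _ = 1%g) ?morph1 //.
by apply: val_inj; rewrite -[LHS]/(GLval _) toGLK // -weyl0 weyl_unitary.
Qed.

(** Trace orthogonality: after multiplication by [weyl (- v)] the right side has trace c, and the
    left side has trace 0 unless [u = v]. *)
Lemma weyl_scale_inj u v c : c != 0 -> weyl u = c *: weyl v -> u = v.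
Proof.
move=> nz_c /(congr1 (fun A => \tr (A *m weyl (- v)))).
rewrite -scalemxAl weylKN weyl_mul !mxtraceZ mxtrace1 natr_F4 mulr1.
rewrite mxtrace_weyl subr_eq0; case: eqP => // _ /eqP.
by rewrite mulr0 eq_sym (negPf nz_c).
Qed.

Lemma weil1 : weil 1%:M = 1%:M.
Proof.
rewrite /weil; under eq_bigr do rewrite mulmx1 weylNK.
by rewrite sumr_const card_mx card_Fp // -scaler_nat natr_F4 scale1r.
Qed.

(** Conjugation by a Weyl operator only rescales the others, whereas [weil g] moves [u] to [u *m g];
    so [g] fixes every basis vector. This gives injectivity on the semidirect product. *)
Lemma weil_eq_weyl g v c : \det g = 1 -> c != 0 ->
  weil g = c *: weyl v -> g = 1%:M /\ v = 0.
Proof.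
move=> det_g nz_c def_g.
have g1 : g = 1%:M.
  apply/row_matrixP=> i; rewrite rowE [in RHS]rowE mulmx1.
  move: (delta_mx 0 i) => u.
  have := weil_weyl det_g u; rewrite def_g -scalemxAl -scalemxAr.
  move/(scalerI nz_c); rewrite [RHS]weyl_comm scalemxAr.
  move/(congr1 (mulmx (weyl (- v)))); rewrite !mulmxA weylNK !mul1mx.
  by apply: weyl_scale_inj; apply: psi_neq0.
split=> //; apply/esym; apply: (weyl_scale_inj nz_c).
by rewrite -def_g g1 weil1 weyl0.
Qed.

(** By Schur's lemma: [weil g *m adj A] commutes with all Weyl operators. Intertwiners can thus be
    identified projectively without computing scalars. *)
Lemma weil_proj_uniq A g : \det g = 1 -> is_unitary A ->
  (forall v, A *m weyl (v *m g) = weyl v *m A) -> proj A = proj (weil g).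
Proof.
move=> det_g uA Ag; have uT := weil_unitary det_g.
have /is_scalar_mxP[c defc] : is_scalar_mx (weil g *m adj A).
  apply: weyl_schur => v; rewrite mulmxA -weil_weyl // -!mulmxA; congr (_ *m _).
  rewrite -[weyl (v *m g)]mul1mx -(eqP uA) -!mulmxA [A *m _]mulmxA Ag -!mulmxA.
  by rewrite is_unitaryV // mulmx1.
have def_g : weil g = c *: A.
  by rewrite -[weil g]mulmx1 -(eqP uA) mulmxA defc mul_scalar_mx.
apply/esym/eqP/proj_eq => //; exists c => //.
by apply: contraNneq (is_unitary_det uT) => c0; rewrite def_g c0 scale0r det0.
Qed.

(** * The Weyl and Weil morphisms and their semidirect product *)

Definition weyl_proj v := proj (weyl v).

Lemma weyl_projM :
  {in [set: 'rV['F_3]_2] &, {morph weyl_proj : u v / (u * v)%g}}.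
Proof.
move=> u v _ _; rewrite /weyl_proj -projM ?weyl_unitary // weyl_mul.
by rewrite projZ ?psi_neq0 ?weyl_unitary.
Qed.

Canonical weyl_proj_morphism := Morphism weyl_projM.

Definition weil_proj (a : {'GL_2['F_3]}) := proj (weil (GLval a)).

(** The product of the two Weil operators intertwines along the product matrix, so uniqueness
    applies. *)
Lemma weil_projM : {in SL 'F_3 2 &, {morph weil_proj : a b / (a * b)%g}}.
Proof.
move=> a b Sa Sb; have [da db] := (SL_det Sa, SL_det Sb).
have dab := SL_det (groupM Sa Sb).
rewrite /weil_proj -projM ?weil_unitary //; apply/esym/weil_proj_uniq => //.
  by rewrite is_unitaryM ?weil_unitary.
move=> v; rewrite GL_MxE [v *m _]mulmxA -mulmxA weil_weyl //.
by rewrite mulmxA weil_weyl // mulmxA.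
Qed.

Canonical weil_proj_morphism := Morphism weil_projM.

Section SemidirectProduct.

Variable K : {group {'GL_2['F_3]}}.
Hypothesis sKSL : K \subset SL 'F_3 2.

Let fK := [morphism of restrm sKSL weil_proj].

(** Multiplied on the left by the Weil operator, the condition becomes the relation [weil_weyl]. *)
Let weyl_weil_act : {in [set: 'rV['F_3]_2] & K,
  morph_act (natural_action K) 'J weyl_proj fK}.
Proof.
move=> v a _ Ka; have da := SL_det (subsetP sKSL a Ka).
rewrite /= /restrm /weyl_proj /weil_proj.
apply: (mulgI (proj (weil (GLval a)))).
rewrite -conjgC -!projM ?weyl_unitary ?weil_unitary // -weil_weyl //.
congr (proj (_ *m weyl _)).
by apply: mx_repr_actE; rewrite inE.
Qed.

Let sd_proj := xsdprodm weyl_weil_act.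

Let injm_sd_proj : ('injm sd_proj)%g.
Proof.
have proj_eq1 A : is_unitary A -> proj A = 1%g ->
    exists2 c, c != 0 & A = c *: weyl 0.
  move=> uA; rewrite -proj1 -weyl0 => /eqP/proj_eq.
  by apply; rewrite ?weyl_unitary.
rewrite injm_xsdprodm; apply/and3P; split.
- apply/subsetP=> v /morphpreP[_ /set1P/proj_eq1[|c nz_c]].
    exact: weyl_unitary.
  by move/(weyl_scale_inj nz_c) => ->; rewrite inE.
- rewrite injm_restrm //; apply/subsetP=> a.
  case/morphpreP=> Sa /set1P/proj_eq1[|c nz_c].
    by rewrite weil_unitary ?SL_det.
  case/(weil_eq_weyl (SL_det Sa) nz_c) => a1 _.
  by rewrite inE; apply/eqP/val_inj.
(* A common element of both images makes a Weil operator proportional to a Weyl operator. *)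
- rewrite -subG1; apply/subsetP=> z.
  case/setIP=> [/morphimP[v _ _ ->] /morphimP[a Ka _ eq_va]].
  have da := SL_det (subsetP sKSL a Ka).
  have/eqP/proj_eq[||c nz_c] := esym eq_va.
  + by rewrite weil_unitary.
  + exact: weyl_unitary.
  case/(weil_eq_weyl da nz_c) => _ ->.
  by rewrite inE /= /weyl_proj weyl0 proj1.
Qed.

(** The product is the image of [sd_proj]. As a group, it can be fed to the generation argument. *)
Lemma weyl_weil_group :
  group_set (weyl_proj @* [set: 'rV['F_3]_2] * weil_proj @* K)%g.
Proof.
have <- : (sd_proj @* setT
           = weyl_proj @* [set: 'rV['F_3]_2] * weil_proj @* K)%g.
  by rewrite im_xsdprodm morphim_restrm setIid.
exact: groupP.
Qed.

Lemma sdprod_isog (G : {group coset_of Z}) :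
  (forall v, proj (weyl v) \in G) ->
  {in K, forall a : {'GL_2['F_3]}, proj (weil (GLval a)) \in G} ->
  (G \subset weyl_proj @* [set: 'rV['F_3]_2] * weil_proj @* K)%g ->
  G \isog [set: sdprod_by (natural_action K)].
Proof.
move=> GE GK sG; rewrite isog_sym.
have -> : G :=: (sd_proj @* setT)%g.
  rewrite im_xsdprodm morphim_restrm setIid; apply/eqP; rewrite eqEsubset sG.
  by rewrite mul_subG //; apply/subsetP=> _ /morphimP[a _ Ka ->];
    [exact: GE | exact: GK].
exact: sub_isog.
Qed.

End SemidirectProduct.

(** * Phases, parity and the Fourier transform *)

Lemma sum_F3 (V : nmodType) (f : 'F_3 -> V) :
  \sum_x f x = f 0 + f 1 + f (- 1).
Proof.
rewrite !big_ord_recl big_ord0 addr0 addrA.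
by congr (f _ + f _ + f _); apply: val_inj.
Qed.

(** A nonzero element is a root of X^3 - 1 = (X - 1)(X - w)(X - w^2). *)
Lemma psi_surj (a : F) : a != 0 -> exists i, a = psi i.
Proof.
move=> nz_a; have: (a - 1) * ((a - w) * (a - w ^+ 2)) = 0.
  have ww : w + w ^+ 2 = - 1 by apply/eqP; rewrite -addr_eq0 addrC addrA w_sum.
  have -> : (a - w) * (a - w ^+ 2) = a ^+ 2 - (w + w ^+ 2) * a + w ^+ 3 by ring.
  rewrite ww w_cubed -(subrr 1) -[X in _ = X - _](expf3 nz_a); ring.
move/eqP; rewrite !mulf_eq0 !subr_eq0 => /or3P[] /eqP->.
- by exists 0.
- by exists 1.
- by exists (- 1).
Qed.

(** The default [0] is reached only at [a = 0]. *)
Definition psi_log (a : F) : 'F_3 := odflt 0 [pick i | a == psi i].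

Lemma psi_logK a : a != 0 -> psi (psi_log a) = a.
Proof.
rewrite /psi_log; case: pickP => [i /eqP-> //|no_log /psi_surj[i def_a]].
by have := no_log i; rewrite def_a eqxx.
Qed.

Definition phase (f : 'F_3 -> 'F_3) : 'M[F]_3 := diag_mx (\row_x psi (f x)).

Definition parity : 'M[F]_3 := \matrix_(x, y) (y == - x)%:R.

(** Unitary without a normalising factor, as 3 = 1 in [F]. *)
Definition fourier : 'M[F]_3 := \matrix_(x, y) psi (x * y).

Lemma mul_phasemx f A x y : (phase f *m A) x y = psi (f x) * A x y.
Proof. by rewrite mul_diag_mx !mxE. Qed.

Lemma mul_mxphase f A x y : (A *m phase f) x y = A x y * psi (f y).
Proof. by rewrite mul_mx_diag !mxE. Qed.

Lemma phase_unitary f : is_unitary (phase f).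
Proof.
apply/eqP/matrixP=> x y; rewrite mul_mx_diag !mxE.
have [->|_] := eqVneq y x; last by rewrite expr0n mul0r.
by rewrite psi_sq psiN mulVf ?psi_neq0.
Qed.

Lemma parity_unitary : is_unitary parity.
Proof.
apply/eqP/matrixP=> x y; rewrite mxE (bigD1 (- x)) //= big1 => [|z nz].
  by rewrite !mxE opprK eqxx expr1n mul1r addr0 eq_sym.
by rewrite !mxE [x == - z]eq_sym eqr_oppLR (negPf nz) expr0n mul0r.
Qed.

Lemma fourier_unitary : is_unitary fourier.
Proof.
apply/eqP/matrixP=> x y; rewrite !mxE.
transitivity (\sum_(z : 'F_3) psi (z * (y - x))).
  by apply: eq_bigr => z _; rewrite !mxE psi_sq -psiD; congr psi; ring.
by rewrite sum_psi subr_eq0 eq_sym.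
Qed.

Lemma mulmx_mx22 v a b c d :
  ((v *m mx22 a b c d) 0 0 = v 0 0 * a + v 0 1 * c) *
  ((v *m mx22 a b c d) 0 1 = v 0 0 * b + v 0 1 * d).
Proof. by split; rewrite mxE sum_ord2 !mxE. Qed.

(** This and the next two relations show that quadratic phases, parity and the Fourier transform
    represent the Weil operators of a unipotent matrix, of -1 and of an element of order 4. *)
Lemma chirp_weyl c v :
  phase (fun x => c * (x * x)) *m weyl (v *m mx22 1 (- c) 0 1) =
  weyl v *m phase (fun x => c * (x * x)).
Proof.
apply/matrixP=> x y; rewrite mul_phasemx mul_mxphase !weylE.
rewrite !mulmx_mx22 !mulr1 mulr0 addr0.
have [->|_] := eqVneq y; last by rewrite !mulr0n mulr0 mul0r.
rewrite !mulr1n -!psiD; congr psi.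
rewrite -[RHS]subr0 -(three_F3 (c * v 0 0 * x)); ring.
Qed.

Lemma parity_weyl v :
  parity *m weyl (v *m mx22 (- 1) 0 0 (- 1)) = weyl v *m parity.
Proof.
apply/matrixP=> x y; rewrite mul_mxweyl mul_weylmx.
rewrite [parity _ _]mxE [parity _ _]mxE !mulmx_mx22.
rewrite !mulr0 addr0 add0r !mulrN1 subr_eq -opprD.
case: eqP => [->|_]; last by rewrite mul0r mulr0.
rewrite mul1r mulr1; congr psi.
rewrite -[LHS]subr0 -(three_F3 (v 0 0 * v 0 1)); ring.
Qed.

Lemma fourier_weyl v :
  fourier *m weyl (v *m mx22 0 1 (- 1) 0) = weyl v *m fourier.
Proof.
apply/matrixP=> x y; rewrite mul_mxweyl mul_weylmx.
rewrite [fourier _ _]mxE [fourier _ _]mxE !mulmx_mx22.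
rewrite -!psiD; congr psi; ring.
Qed.

(** * Generation of the projective unitary group *)

Section Generation.

Variable G : {group coset_of Z}.
Hypothesis G_weyl : forall v, proj (weyl v) \in G.
Hypothesis G_weil : forall g, \det g = 1 -> proj (weil g) \in G.

Let G_intertwiner A g : \det g = 1 -> is_unitary A ->
  (forall v, A *m weyl (v *m g) = weyl v *m A) -> proj A \in G.
Proof. by move=> det_g uA /(weil_proj_uniq det_g uA) ->; apply: G_weil. Qed.

Let G_parity : proj parity \in G.
Proof.
apply: (G_intertwiner _ parity_unitary parity_weyl).
by rewrite det_mx22E; ring.
Qed.

Let G_fourier : proj fourier \in G.
Proof.
apply: (G_intertwiner _ fourier_unitary fourier_weyl).
by rewrite det_mx22E; ring.
Qed.

(* Every function on F_3 is a polynomial of degree at most 2; the constant,   *)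
(* linear and quadratic terms give a scalar, a Weyl operator and a chirp.     *)
Let G_phase f : proj (phase f) \in G.
Proof.
pose b := f (- 1) - f 1; pose c := - (f 0 + f 1 + f (- 1)).
pose v : 'rV['F_3]_2 := \row_i if i == 0 then 0 else b.
have fE x : f x = f 0 + (b * x + c * (x * x)).
  rewrite /b /c; case/or3P: (F3_cases x) => /eqP->.
  - by ring.
  - rewrite -[LHS]subr0 -(three_F3 (f 1)); ring.
  - rewrite -[LHS]subr0 -(three_F3 (f (- 1))); ring.
have -> : phase f = psi (f 0) *: (weyl v *m phase (fun x => c * (x * x))).
  apply/matrixP=> x y; rewrite [RHS]mxE mul_weylmx !mxE fE /= addr0 mul0r subr0.
  by rewrite mulrnAr mulrnAr !psiD.
rewrite projZ ?psi_neq0 ?is_unitaryM ?weyl_unitary ?phase_unitary //.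
rewrite projM ?weyl_unitary ?phase_unitary // groupM //.
apply: (G_intertwiner _ (phase_unitary _) (chirp_weyl c)).
by rewrite det_mx22E; ring.
Qed.

Let G_mulr A B : is_unitary A -> is_unitary B -> proj B \in G ->
  proj (A *m B) \in G -> proj A \in G.
Proof. by move=> uA uB GB; rewrite projM // groupMr. Qed.

Let is_unitary_row A x y : is_unitary A ->
  A x 0 * A y 0 ^+ 2 + A x 1 * A y 1 ^+ 2 + A x (- 1) * A y (- 1) ^+ 2
  = (x == y)%:R.
Proof.
move=> /is_unitaryV/matrixP/(_ x y); rewrite !mxE => <-.
by rewrite sum_F3 !mxE.
Qed.

(** With this, the norm of a row counts its nonzero entries modulo 2. *)
Let cube_neq0 (a : F) : a * a ^+ 2 = (a != 0)%:R.
Proof.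
by rewrite -exprS; have [->|/expf3] := eqVneq a 0; rewrite ?expr0n.
Qed.

(** In the order 0, 1, -1 the matrix is lower triangular; orthogonality of its rows makes it
    diagonal, that is, a phase matrix. *)
Let G_diagonal A : is_unitary A ->
  A 0 1 = 0 -> A 0 (- 1) = 0 -> A 1 (- 1) = 0 -> proj A \in G.
Proof.
move=> uA A01 A02 A12; have row x y := is_unitary_row x y uA.
have A00: A 0 0 != 0.
  apply: contra_eqN (row 0 0) => /eqP->.
  by rewrite A01 A02 !mul0r !addr0 eq_sym oner_eq0.
have col0 x : x != 0 -> A x 0 = 0.
  move=> /negPf nz; have /eqP := row x 0.
  by rewrite A01 A02 nz !expr0n !mulr0 !addr0 mulf_eq0 expf_eq0 (negPf A00)
             orbF => /eqP.
have [A10 A20] : A 1 0 = 0 /\ A (- 1) 0 = 0 by split; apply: col0.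
have A11: A 1 1 != 0.
  apply: contra_eqN (row 1 1) => /eqP->.
  by rewrite A10 A12 !mul0r !addr0 eq_sym oner_eq0.
have A21 : A (- 1) 1 = 0.
  have /eqP := row (- 1) 1.
  by rewrite A10 A12 A20 mul0r expr0n mulr0 addr0 add0r mulf_eq0 expf_eq0
             (negPf A11) orbF => /eqP.
have A22: A (- 1) (- 1) != 0.
  apply: contra_eqN (row (- 1) (- 1)) => /eqP->.
  by rewrite A20 A21 !mul0r !addr0 eq_sym oner_eq0.
rewrite (_ : A = phase (fun x => psi_log (A x x))) //.
apply/matrixP=> x y; rewrite !mxE.
by case/or3P: (F3_cases x) => /eqP->; case/or3P: (F3_cases y) => /eqP->;
  rewrite ?A01 ?A02 ?A10 ?A12 ?A20 ?A21 ?psi_logK.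
Qed.

(** If the entry at (1, -1) is nonzero, orthogonality to row 0 and the norm of row 1 force the entry
    at (1, 1) to vanish; parity then swaps columns 1 and -1. *)
Let G_monomial A : is_unitary A -> A 0 1 = 0 -> A 0 (- 1) = 0 -> proj A \in G.
Proof.
move=> uA A01 A02; have [/eqP A12|A12] := boolP (A 1 (- 1) == 0).
  exact: G_diagonal.
have parE x y : (A *m parity) x y = A x (- y).
  rewrite mxE (bigD1 (- y)) //= big1 => [|z nz]; rewrite mxE.
    by rewrite opprK eqxx mulr1 addr0.
  by rewrite -eqr_oppLR eq_sym (negPf nz) mulr0.
apply: (G_mulr uA parity_unitary G_parity).
apply: G_diagonal; rewrite ?is_unitaryM ?parity_unitary ?parE ?opprK //.
have := is_unitary_row 0 0 uA; have := is_unitary_row 1 0 uA.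
have := is_unitary_row 1 1 uA.
rewrite A01 A02 !cube_neq0 A12 ?eqxx expr0n !mulr0 !addr0.
have [->|nz00] := eqVneq (A 0 0) 0.
  by move=> _ _ /eqP; rewrite eq_sym oner_eq0.
move=> row1 /eqP; rewrite mulf_eq0 expf_eq0 (negPf nz00) orbF => /eqP A10 _.
move: row1; rewrite A10 eqxx add0r; have [//|_] := eqVneq (A 1 1) 0.
by rewrite F4_char2 => /eqP; rewrite eq_sym oner_eq0.
Qed.

(** A Weyl shift moves column [j] to column 0. *)
Let G_pivot A j :
  is_unitary A -> (forall x, x != j -> A 0 x = 0) -> proj A \in G.
Proof.
move=> uA A0; pose v : 'rV['F_3]_2 := \row_i if i == 0 then - j else 0.
apply: (G_mulr uA (weyl_unitary v) (G_weyl v)).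
by apply: G_monomial; rewrite ?is_unitaryM ?weyl_unitary // mul_mxweyl !mxE /=
  A0 ?mul0r // opprK -subr_eq0 addrK.
Qed.

(* A row with no zero entry is turned into a row with a single nonzero entry  *)
(* by a diagonal matrix followed by the Fourier transform.                    *)
Lemma unitary_generated A : is_unitary A -> proj A \in G.
Proof.
move=> uA.
have row0 : ((A 0 0 != 0) (+) (A 0 1 != 0) (+) (A 0 (- 1) != 0)).
  have := is_unitary_row 0 0 uA; rewrite !cube_neq0 -!natrD natr_F4 !oddD !oddb.
  by case: (_ (+) _) => // /eqP; rewrite eq_sym oner_eq0.
have [A00|A00] := eqVneq (A 0 0) 0; have [A01|A01] := eqVneq (A 0 1) 0;
  have [A02|A02] := eqVneq (A 0 (- 1)) 0;
  rewrite ?A00 ?A01 ?A02 ?eqxx // in row0.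
- apply: (@G_pivot A (- 1)) => // x.
  by case/or3P: (F3_cases x) => /eqP-> //; rewrite eqxx.
- apply: (@G_pivot A 1) => // x.
  by case/or3P: (F3_cases x) => /eqP-> //; rewrite eqxx.
- apply: (@G_pivot A 0) => // x.
  by case/or3P: (F3_cases x) => /eqP-> //; rewrite eqxx.
have nzA x : A 0 x != 0 by case/or3P: (F3_cases x) => /eqP->.
pose f x := - psi_log (A 0 x).
apply: (G_mulr uA (phase_unitary f) (G_phase f)).
have uAf : is_unitary (A *m phase f) by rewrite is_unitaryM ?phase_unitary.
apply: (G_mulr uAf fourier_unitary G_fourier).
have rowE y : (A *m phase f *m fourier) 0 y = (y == 0)%:R.
  rewrite mxE -sum_psi; apply: eq_bigr => x _.
  by rewrite mul_mxphase !mxE /f psiN psi_logK // mulfV ?mul1r.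
by apply: G_monomial; [rewrite is_unitaryM ?fourier_unitary | rewrite rowE ..].
Qed.

End Generation.

(** * Determinants and the two isomorphisms *)

Lemma SL_GLval g : \det g = 1 ->
  exists2 a : {'GL_2['F_3]}, a \in SL 'F_3 2 & GLval a = g.
Proof.
move=> det_g; have Ug : g \in unitmx by rewrite unitmxE det_g unitr1.
by exists (FinRing.Unit Ug : {'GL_2['F_3]}); rewrite ?inE ?det_g.
Qed.

Lemma proj_det A B : is_unitary A -> is_unitary B -> proj A = proj B ->
  \det A = \det B.
Proof.
move=> uA uB /eqP/(proj_eq uA uB)[c nz_c ->].
by rewrite detZ expf3 // mul1r.
Qed.

(* W(-v) = W(v)^-1 is conjugate to W(v), so the square of the determinant is  *)
(* 1, and so is its cube.                                                     *)
Lemma det_weyl v : \det (weyl v) = 1.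
Proof.
have detN : \det (weyl (- v)) = \det (weyl v).
  have := congr1 determinant (parity_weyl v); rewrite !det_mulmx mulrC.
  move/(mulIf (is_unitary_det parity_unitary)) <-; congr (\det (weyl _)).
  by apply: row2P; rewrite mulmx_mx22 mxE; ring.
have := congr1 determinant (weylNK v); rewrite det_mulmx detN det1 => det2.
have := expf3 (is_unitary_det (weyl_unitary v)).
by rewrite exprS expr2 det2 mulr1.
Qed.

Lemma unitary_GLval a : a \in U -> is_unitary (GLval a) /\ toGL (GLval a) = a.
Proof.
rewrite inE => ua; split=> //; apply: val_inj.
by rewrite -[LHS]/(GLval _) toGLK.
Qed.

Lemma proj_unitaryE A : is_unitary A -> proj A \in (U / Z)%g.
Proof. by move=> uA; rewrite mem_quotient ?mem_toGL. Qed.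

Lemma weyl_weil_cover A : is_unitary A ->
  proj A \in (weyl_proj @* [set: 'rV['F_3]_2] * weil_proj @* SL 'F_3 2)%g.
Proof.
pose G := Group (weyl_weil_group (subxx (SL 'F_3 2))).
rewrite -[_ \in _]/(proj A \in G); apply: unitary_generated => [v|g det_g].
  rewrite -[proj _]mulg1; apply: mem_mulg => //.
  by apply: mem_morphim; rewrite inE.
have [a Sa <-] := SL_GLval det_g.
by rewrite -[proj _]mul1g; apply: mem_mulg => //; apply: (mem_morphim _ Sa Sa).
Qed.

Lemma proj_unitary_isog :
  proj_unitary 3 cardF \isog [set: sdprod_by (natural_action (SL 'F_3 2))].
Proof.
apply: (sdprod_isog (subxx _)) => [v|a Sa|].
- exact/proj_unitaryE/weyl_unitary.
- by apply/proj_unitaryE/weil_unitary/SL_det.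
apply/subsetP=> _ /morphimP[a _ /unitary_GLval[ua def_a] ->] /=.
by rewrite -{}def_a weyl_weil_cover.
Qed.

Definition det_weil (a : {'GL_2['F_3]}) : {unit F} :=
  insubd (1%g : {unit F}) (\det (weil (GLval a))).

Lemma det_weilE a : a \in SL 'F_3 2 ->
  FinRing.uval (det_weil a) = \det (weil (GLval a)).
Proof.
move=> /SL_det/weil_unitary/is_unitary_det da.
by apply: (insubdK (1%g : {unit F})); rewrite [_ \in _]unitfE.
Qed.

(** Weil operators multiply up to a scalar, whose cube 1 disappears in the determinant. *)
Lemma det_weilM : {in SL 'F_3 2 &, {morph det_weil : a b / (a * b)%g}}.
Proof.
move=> a b Sa Sb; apply: val_inj; rewrite /= !det_weilE ?groupM //.
rewrite -det_mulmx; apply: proj_det.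
- exact/weil_unitary/SL_det/groupM.
- by rewrite is_unitaryM ?weil_unitary ?SL_det.
by rewrite projM ?weil_unitary ?SL_det //; apply: weil_projM.
Qed.

Canonical det_weil_morphism := Morphism det_weilM.

(** The witness is a transvection: its Weil operator is proportional to a quadratic phase, of
    determinant psi(0 + 1 + 1) = w^2. *)
Lemma det_weil_neq1 : exists2 a, a \in SL 'F_3 2 & det_weil a != 1%g.
Proof.
pose g : 'M['F_3]_2 := mx22 1 (- 1) 0 1.
have det_g : \det g = 1 by rewrite det_mx22E; ring.
have [a Sa def_a] := SL_GLval det_g.
exists a => //; rewrite -val_eqE /= det_weilE // def_a.
have uP := phase_unitary (fun x => 1 * (x * x)).
rewrite -(proj_det uP (weil_unitary det_g)); last first.
  exact: weil_proj_uniq det_g uP (chirp_weyl 1).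
rewrite det_diag; under eq_bigr do rewrite mxE.
by rewrite -(big_morph psi psiD psi0) psi_eq1 sum_F3.
Qed.

Local Notation Q := ('ker det_weil)%G.

Lemma sub_ker_det_weil : Q \subset SL 'F_3 2.
Proof. exact: subsetIl. Qed.

Lemma mem_ker_det_weil (a : {'GL_2['F_3]}) : a \in SL 'F_3 2 ->
  (a \in Q) = (\det (weil (GLval a)) == 1).
Proof.
by move=> Sa; rewrite !in_setI Sa inE in_set1 -[LHS]val_eqE /= det_weilE.
Qed.

Lemma card_ker_det_weil : #|Q| = 8%N.
Proof.
have oU : #|[set: {unit F}]| = 3%N by rewrite card_finField_unit cardF.
have prU : prime #|[set: {unit F}]| by rewrite oU.
have iQ : #|SL 'F_3 2 : Q|%g = 3%N.
  exact: etrans (index_ker_prime prU det_weil_neq1) oU.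
have := Lagrange sub_ker_det_weil; rewrite iQ card_SL23.
by move=> e; apply/eqP; rewrite -(eqn_pmul2r (ltn0Sn 2)) e.
Qed.

Lemma Sylow_ker_det_weil : ('Syl_2(SL 'F_3 2) = [set Q])%g.
Proof.
apply: normal_SylowE (ker_normal _).
by rewrite pHallE sub_ker_det_weil card_ker_det_weil card_SL23 p_part.
Qed.

Lemma proj_special_unitary_isog :
  proj_special_unitary 3 cardF \isog [set: sdprod_by (natural_action Q)].
Proof.
pose SU : {group {'GL_3[F]}} := (U :&: SL F 3)%G.
have nZ : (SU \subset 'N(Z))%g.
  by apply: subset_trans (subsetIl _ _) unitary_normZ.
have SU_Z : SU :&: scalars F 3 = Z :&: SU.
  apply/setP=> a; rewrite !in_setI.
  by case: (a \in U) => //=; rewrite andbC.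
(* The second isomorphism theorem places the group inside the quotient by [Z], where [proj] takes
   its values. *)
have iso2 : (SU / (SU :&: scalars F 3) \isog SU / Z)%g.
  by rewrite SU_Z; apply: second_isog.
apply: isog_trans iso2 _.
have projSU A : is_unitary A -> \det A = 1 -> proj A \in (SU / Z)%g.
  move=> uA dA; rewrite mem_quotient // inE mem_toGL // inE toGLK // dA.
  exact: eqxx.
apply: (sdprod_isog sub_ker_det_weil) => [v|a Qa|].
- exact: projSU (weyl_unitary v) (det_weyl v).
- have Sa := subsetP sub_ker_det_weil a Qa.
  apply: projSU; first by rewrite weil_unitary ?SL_det.
  by move: Qa; rewrite mem_ker_det_weil // => /eqP.
apply/subsetP=> _ /morphimP[x _ /setIP[/unitary_GLval[ux def_x]] SLx ->] /=.
have dx : \det (GLval x) = 1 by move: SLx; rewrite inE => /eqP.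
have -> : coset Z x = proj (GLval x) by rewrite /proj def_x.
have := weyl_weil_cover ux.
case/imset2P=> _ _ /morphimP[v _ _ ->] /morphimP[a _ Sa ->] def_p.
rewrite def_p; apply: mem_mulg.
  by apply: mem_morphim; rewrite inE.
apply: (mem_morphim _ Sa); rewrite mem_ker_det_weil //.
have ua := weil_unitary (SL_det Sa).
(* Up to a scalar, [x] is a Weyl operator, of determinant 1, times [weil (GLval a)]. *)
have <- : \det (GLval x) = \det (weil (GLval a)); last by rewrite dx.
rewrite -[RHS]mul1r -(det_weyl v) -det_mulmx; apply: proj_det => //.
  by rewrite is_unitaryM ?weyl_unitary.
by rewrite projM ?weyl_unitary.
Qed.

End Heisenberg.

Local Close Scope ring_scope.
Local Open Scope group_scope.

Theorem corollary4p9 (F : finFieldType) (cardF : #|F| = 4) :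
  (proj_unitary 3 cardF
     \isog [set: sdprod_by (natural_action (SL 'F_3 2))])
  /\ (exists Q : {group {'GL_2['F_3]}},
        [/\ 'Syl_2(SL 'F_3 2) = [set Q],
            Q \isog 'Q_8
          & proj_special_unitary 3 cardF
              \isog [set: sdprod_by (natural_action Q)]]).
Proof.
have [w w_neq0 w_neq1] : exists2 w : F, w != 0%R & w != 1%R.
  have [w] : exists w, w \in ~: [set 0%R; 1%R : F].
    apply/set0Pn.
    by rewrite -card_gt0 cardsCs setCK cards2 cardF eq_sym oner_eq0.
  by rewrite !inE negb_or => /andP[]; exists w.
split; first exact: (proj_unitary_isog cardF w_neq0 w_neq1).
exists ('ker (det_weil_morphism cardF w_neq0 w_neq1))%G; split.
- exact: Sylow_ker_det_weil.
- apply: SL23_quaternion; first exact: sub_ker_det_weil.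
  exact: card_ker_det_weil.
- exact: proj_special_unitary_isog.
Qed.
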